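(* Let $0\leq n<m$ be natural numbers. Then for every $Z\in\{A,B,C,D,E,F\}$, player $\forall$ has a winning strategy in the Seurat game $\mathbf{G}^2(Z_{m,n},Z^*_{m,n})$.
   Context: For a nonzero integer $z$, $\mathsf{odd}(z)$ is the result of dividing $z$ by the largest power of $2$ dividing it. For $0\leq n<m$ and $w,x,y,z\in\{0,1\}$, let $p=2^m+2^n$ and define a digraph on vertices $\{1,\ldots,p\}$ with adjacency matrix $M_{m,n}$ (entry $[i,j]=1$ means an edge $i\to j$): if $1\leq i,j\leq 2^m$ or $2^m+1\leq i,j\leq p$, then $M[i,j]=1$ iff $i\neq j$ and $\mathsf{odd}(j-i)\equiv 1\pmod 4$; if $1\leq i\leq 2^m<j\leq p$, then $M[i,j]=w$ if $i+j$ is even and $M[i,j]=x$ otherwise; if $1\leq j\leq 2^m<i\leq p$, then $M[i,j]=y$ if $i+j$ is even and $M[i,j]=z$ otherwise. The digraphs $Z_{m,n},Z^*_{m,n}$ are obtained with the following values of $(w,x,y,z)$: $A:(1,0,0,0)$, $A^*:(0,1,0,0)$, $B:(0,0,1,0)$, $B^*:(0,0,0,1)$, $C:(1,0,1,0)$, $C^*:(0,1,0,1)$, $D:(1,0,0,1)$, $D^*:(0,1,1,0)$, $E:(1,1,1,0)$, $E^*:(1,1,0,1)$, $F:(1,0,1,1)$, $F^*:(0,1,1,1)$. Seurat game $\mathbf{G}^k(G,H)$ for digraphs $G,H$: two players $\forall,\exists$, a set $\mathbf{Col}$ of $k$ colours. A position is a pair of functions $g:\mathbf{Col}\to\wp(G)$,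 $h:\mathbf{Col}\to\wp(H)$, initially all empty. In each of $\omega$ rounds $\forall$ chooses a colour $c$, one of the graphs and a subset of its vertices; $\exists$ then chooses a subset of the other graph; $c$ is then assigned these two sets (erasing its previous use). The palette of a vertex is the set of colours whose set contains it; $P^G$ is the set of vertices of $G$ with palette exactly $P$. $\forall$ wins in round $n$ if at its beginning (C1) some palette $P$ has $P^G$ empty and $P^H$ nonempty or vice versa, or (C2) there are palettes $P_1,P_2$ with an edge from $P_1^G$ to $P_2^G$ but none from $P_1^H$ to $P_2^H$, or vice versa. $\forall$ has a winning strategy if he can guarantee a win in finitely many rounds. *)

(* Defs.v *)
From mathcomp Require Import all_boot all_order all_algebra.

Set Implicit Arguments.
Unset Strict Implicit.
Unset Printing Implicit Defensive.

Record digraph := Digraph { vertex :> finType; edge : rel vertex }.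
Arguments edge : clear implicits.

(* The division is exact and keeps the sign of z: odd_part (-1) is -1,
   which is congruent to 3 modulo 4.  Meaningful for z != 0 only. *)
Definition odd_part (z : int) : int := (z %/ (2 ^ logn 2 `|z|)%N%:Z)%Z.

(* The arguments i and j are the 1-based labels of the vertices. *)
Definition stockmeyer_entry (m : nat) (w x y z : bool) (i j : nat) : bool :=
  if (i <= 2 ^ m) == (j <= 2 ^ m) then
    (i != j) && (odd_part (j%:Z - i%:Z)%R == 1 %[mod 4])%Z
  else if i <= 2 ^ m then (if ~~ odd (i + j) then w else x)
  else (if ~~ odd (i + j) then y else z).

(* The ordinal i < 2 ^ m + 2 ^ n stands for the vertex labelled i.+1. *)
Definition stockmeyer_digraph (m n : nat) (w x y z : bool) : digraph :=
  @Digraph 'I_(2 ^ m + 2 ^ n)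
    (fun i j => stockmeyer_entry m w x y z i.+1 j.+1).

Inductive stockmeyer_family :=
  FamilyA | FamilyB | FamilyC | FamilyD | FamilyE | FamilyF.

Definition stockmeyer (Z : stockmeyer_family) (m n : nat) : digraph :=
  match Z with
  | FamilyA => stockmeyer_digraph m n true  false false false
  | FamilyB => stockmeyer_digraph m n false false true  false
  | FamilyC => stockmeyer_digraph m n true  false true  false
  | FamilyD => stockmeyer_digraph m n true  false false true
  | FamilyE => stockmeyer_digraph m n true  true  true  false
  | FamilyF => stockmeyer_digraph m n true  false true  true
  end.

Definition stockmeyer_star (Z : stockmeyer_family) (m n : nat) : digraph :=
  match Z with
  | FamilyA => stockmeyer_digraph m n false true  false false
  | FamilyB => stockmeyer_digraph m n false false false true
  | FamilyC => stockmeyer_digraph m n false true  false true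
  | FamilyD => stockmeyer_digraph m n false true  true  false
  | FamilyE => stockmeyer_digraph m n true  true  false true
  | FamilyF => stockmeyer_digraph m n false true  true  true
  end.

Definition coloring (k : nat) (G : digraph) : Type := {ffun 'I_k -> {set G}}.

Definition empty_coloring (k : nat) (G : digraph) : coloring k G :=
  [ffun => set0].

Definition recolor (k : nat) (G : digraph) (g : coloring k G) (c : 'I_k)
    (A : {set G}) : coloring k G :=
  [ffun c' => if c' == c then A else g c'].

Definition palette (k : nat) (G : digraph) (g : coloring k G) (v : G) :
    {set 'I_k} :=
  [set c | v \in g c].

Definition palette_class (k : nat) (G : digraph) (g : coloring k G)
    (P : {set 'I_k}) : {set G} :=
  [set v | palette g v == P].

Definition palette_edge (k : nat) (G : digraph) (g : coloring k G)
    (P1 P2 : {set 'I_k}) : Prop :=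
  exists u v : G,
    [/\ u \in palette_class g P1, v \in palette_class g P2 & edge G u v].

Section Game.
Variables (k : nat) (G H : digraph).

Definition position : Type := (coloring k G * coloring k H)%type.

Definition initial_position : position :=
  (empty_coloring k G, empty_coloring k H).

Definition C1 (p : position) : Prop :=
  exists P : {set 'I_k},
    (palette_class p.1 P = set0 /\ palette_class p.2 P <> set0) \/
    (palette_class p.1 P <> set0 /\ palette_class p.2 P = set0).

Definition C2 (p : position) : Prop :=
  exists P1 P2 : {set 'I_k},
    (palette_edge p.1 P1 P2 /\ ~ palette_edge p.2 P1 P2) \/
    (~ palette_edge p.1 P1 P2 /\ palette_edge p.2 P1 P2).

(* A colour, together with a set of vertices of G (inl) or of H (inr). *)
Definition seurat_move : Type := ('I_k * ({set G} + {set H}))%type.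

(* p' can be reached from p when player forall plays a and player exists
   answers with some subset of the other graph. *)
Definition seurat_round (p : position) (a : seurat_move) (p' : position) : Prop :=
  match a with
  | (c, inl A) => exists B : {set H}, p' = (recolor p.1 c A, recolor p.2 c B)
  | (c, inr B) => exists A : {set G}, p' = (recolor p.1 c A, recolor p.2 c B)
  end.

(* A strategy of player forall reads all positions up to the current one. *)
Definition strategy : Type := seq position -> seurat_move.

(* The positions p 0, p 1, ... at the beginnings of the omega rounds.  Play is
   not stopped at a win of player forall; what happens afterwards does not
   matter in winning_strategy. *)
Definition play_according_to (s : strategy) (p : nat -> position) : Prop :=
  p 0 = initial_position /\
  forall i : nat, seurat_round (p i) (s (mkseq p i.+1)) (p i.+1).

Definition winning_strategy (s : strategy) : Prop :=
  forall p : nat -> position, play_according_to s p ->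
    exists i : nat, C1 (p i) \/ C2 (p i).

End Game.

Definition forall_wins_seurat (k : nat) (G H : digraph) : Prop :=
  exists s : strategy k G H, winning_strategy s.

(* Main.v *)
(* If forall cannot win, the safe positions give a bisimulation between vertex
   sets of the two digraphs, with one of the two colours remembered and the
   other one free to be replayed.  Such a bisimulation preserves cardinalities,
   so related singletons have as many out- and in-neighbours in any pair of
   definable sets: the game is at least as strong as colour refinement.
   Replacing Z by Z* exchanges w with x and y with z.  In both digraphs the
   degrees separate the first halves of the two tournaments from the second
   halves, so by induction the union of an initial interval of size 2^(m-n) of
   the large tournament and of the first vertex of the small one (the apex,
   label 2^m+1) is definable.  There the apex is definable, or else (when few vertices
   remain) the degrees already contradict each other; halving further, so is vertex 1.  But
   the adjacency between vertex 1 and the apex is (w, y) in one digraph and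
   (x, z) in the other. *)
Require Import Defs.
From mathcomp Require Import all_boot all_order all_algebra.
From Stdlib Require Import Classical ClassicalEpsilon.
From mathcomp Require Import zify.

Set Implicit Arguments.
Unset Strict Implicit.
Unset Printing Implicit Defensive.

(** * The game and bisimulations of vertex sets *)

Section Determinacy.
Variables (k : nat) (G H : digraph).
Implicit Types p : position k.+1 G H.

(** A win by the beginning of the [n]-th round from now, possibly earlier: the left disjunct makes
    the predicate monotone in [n]. *)
Fixpoint forces n p : Prop :=
  if n is n'.+1 then
    forces n' p \/ exists a, forall p', seurat_round p a p' -> forces n' p'
  else C1 p \/ C2 p.

Lemma forces_leq n n' p : n <= n' -> forces n p -> forces n' p.
Proof.
elim: n' => [|n' IHn']; first by rewrite leqn0 => /eqP->.
by rewrite leq_eqVlt => /orP[/eqP-> //|lt_nn' fp]; left; apply: IHn'.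
Qed.

Lemma forces_wins n :
  forces n (initial_position k.+1 G H) -> forall_wins_seurat k.+1 G H.
Proof.
(* A good move makes strict progress: all replies are forced within [i] rounds although [p] is not.
   The least number of rounds drops at each move, so a strategy reading only the last position
   wins. *)
move=> f0; pose good p a := exists2 i, ~ forces i p &
  forall p', seurat_round p a p' -> forces i p'.
pose a0 : seurat_move k.+1 G H := (ord0, inl set0).
exists (fun h => epsilon (inhabits a0) (good (last (initial_position k.+1 G H) h))).
move=> p [p0 pS].
suff: forall j i, forces j (p i) -> exists i, C1 (p i) \/ C2 (p i).
  by move/(_ n 0); apply; rewrite p0.
elim=> [|j IHj] i; first by exists i.
move=> fj; have [/IHj //|nfj] := classic (forces j (p i)).
apply: (IHj i.+1); move: (pS i).
have -> : last (initial_position k.+1 G H) (mkseq p i.+1) = p i.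
  by rewrite (last_nth (p 0)) size_mkseq -[_ :: _]/(_ :: mkseq p i.+1) /= nth_mkseq.
have [a good_a]: exists a, good (p i) a by case: fj => // -[a fa]; exists a, j.
have [j0 nf f] := epsilon_spec (inhabits a0) _ (ex_intro _ a good_a).
move/f; apply: forces_leq; rewrite leqNgt; apply/negP => lt_j_j0.
by apply: nf; apply: forces_leq fj.
Qed.

Definition safe p := forall n, ~ forces n p.

Lemma safe_reply p a : safe p -> exists2 p', seurat_round p a p' & safe p'.
Proof.
move=> sp; apply: NNPP => no_reply.
have fa p' : exists n, seurat_round p a p' -> forces n p'.
  have [r|] := classic (seurat_round p a p'); last by exists 0.
  have [n f] : exists n, forces n p'.
    apply: NNPP => nf; apply: no_reply; exists p' => // n f.
    by apply: nf; exists n.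
  by exists n.
(* There are finitely many positions, so the bounds for the single replies have a maximum, valid for
   all of them. *)
have [f fP] := fin_all_exists (T := (coloring k.+1 G * coloring k.+1 H)%type) fa.
apply: (sp (\max_p' f p').+1); right; exists a => p' r.
exact: forces_leq (leq_bigmax p') (fP p' r).
Qed.

End Determinacy.

(** The failure of both [C1] and [C2] for two colours, a palette being a pair of membership
    values. *)
Definition same_pattern (G H : digraph) (X Y : {set G}) (X' Y' : {set H}) :=
  (forall a b, (exists u : G, (u \in X) = a /\ (u \in Y) = b) <->
               (exists u : H, (u \in X') = a /\ (u \in Y') = b)) /\
  (forall a b c d,
     (exists u v : G, [/\ (u \in X) = a, (u \in Y) = b,
                         (v \in X) = c, (v \in Y) = d & edge G u v]) <->
     (exists u v : H, [/\ (u \in X') = a, (u \in Y') = b,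
                         (v \in X') = c, (v \in Y') = d & edge H u v])).

(** Only [Y] and [Y'] are related afterwards: the colour holding [X] is the one to be replayed
    next. *)
Definition forth (G H : digraph) (L : {set G} -> {set H} -> Prop) :=
  forall X X', L X X' ->
    forall Y, exists2 Y', L Y Y' & same_pattern X Y X' Y'.

Definition bisimulation (G H : digraph) (L : {set G} -> {set H} -> Prop) :=
  forth L /\ forth (fun X X' => L X' X).

Lemma other_colour (c d : 'I_2) : d != c -> d = rev_ord c.
Proof.
by case: c d => -[|[|//]] c1 [[|[|//]] d1] // _; apply: val_inj.
Qed.

Section SafeBisimulation.
Variables G H : digraph.

Definition safe_pair (X : {set G}) (X' : {set H}) :=
  exists (g : coloring 2 G) (h : coloring 2 H) c, [/\ safe (g, h), g c = X & h c = X'].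

Lemma palette_class2 (K : digraph) (g : coloring 2 K) c a b v :
  (v \in palette_class g [set d | if d == c then a else b]) =
  ((v \in g c) == a) && ((v \in g (rev_ord c)) == b).
Proof.
have cc : rev_ord c != c by rewrite -val_eqE /=; case: c => -[|[]].
rewrite inE; apply/eqP/andP => [/setP P | [/eqP<- /eqP<-]].
  have := P c; have := P (rev_ord c).
  by rewrite !inE eqxx (negbTE cc) => -> ->.
apply/setP => d; rewrite !inE; case: eqP => [-> //|/eqP].
by move/other_colour->.
Qed.

Lemma safe_pattern (g : coloring 2 G) (h : coloring 2 H) c : safe (g, h) ->
  same_pattern (g c) (g (rev_ord c)) (h c) (h (rev_ord c)).
Proof.
move=> sgh; have [nC1 nC2] : ~ C1 (g, h) /\ ~ C2 (g, h).
  by split=> C; apply: (sgh 0); [left | right].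
pose pal (a b : bool) : {set 'I_2} := [set d | if d == c then a else b].
have classP K (f : coloring 2 K) a b v :
    v \in palette_class f (pal a b) <-> (v \in f c) = a /\ (v \in f (rev_ord c)) = b.
  by rewrite palette_class2; split=> [/andP[/eqP-> /eqP->]|[-> ->]]; rewrite ?eqxx.
have class0 K (f : coloring 2 K) a b : palette_class f (pal a b) <> set0 <->
    exists u, (u \in f c) = a /\ (u \in f (rev_ord c)) = b.
  split=> [/eqP/set0Pn[u /classP]|[u /classP uP]]; first by exists u.
  by apply/eqP/set0Pn; exists u.
have edgeP K (f : coloring 2 K) a b a' b' : palette_edge f (pal a b) (pal a' b') <->
    exists u v, [/\ (u \in f c) = a, (u \in f (rev_ord c)) = b,
                    (v \in f c) = a', (v \in f (rev_ord c)) = b' & edge K u v].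
  split=> -[u [v]]; first by case=> /classP[? ?] /classP[? ?] ?; exists u, v.
  by case=> ? ? ? ? ?; exists u, v; split=> //; apply/classP.
split=> a b => [|a' b'].
  rewrite -!class0; split=> ne; apply: NNPP => /NNPP e; apply: nC1; exists (pal a b).
    by right.
  by left.
rewrite -!edgeP; split=> ne; apply: NNPP => e; apply: nC2; exists (pal a b), (pal a' b').
  by left.
by right.
Qed.

Lemma recolor_eq k (K : digraph) (f : coloring k K) c A : recolor f c A c = A.
Proof. by rewrite ffunE eqxx. Qed.

Lemma recolor_neq k (K : digraph) (f : coloring k K) c d A :
  d != c -> recolor f c A d = f d.
Proof. by rewrite ffunE => /negbTE->. Qed.

Lemma safe_bisimulation : bisimulation safe_pair.
Proof.
have cc c : c != rev_ord c :> 'I_2 by rewrite -val_eqE /=; case: c => -[|[]].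
split=> [X X' | X' X] [g [h [c [sgh gc hc]]]] Y.
  have [_ [Y' ->] s] := safe_reply (rev_ord c, inl Y) sgh.
  exists Y'; first by exists (recolor g (rev_ord c) Y), (recolor h (rev_ord c) Y'), (rev_ord c);
    rewrite !recolor_eq.
  by have := safe_pattern c s; rewrite !recolor_eq !recolor_neq // gc hc.
have [_ [Y' ->] s] := safe_reply (rev_ord c, inr Y) sgh.
exists Y'; first by exists (recolor g (rev_ord c) Y'), (recolor h (rev_ord c) Y), (rev_ord c);
  rewrite !recolor_eq.
have := safe_pattern c s; rewrite !recolor_eq !recolor_neq // gc hc.
by case=> pat1 pat2; split=> *; symmetry; [apply: pat1 | apply: pat2].
Qed.

Lemma bisimulation_of_loss : ~ forall_wins_seurat 2 G H ->
  exists2 L : {set G} -> {set H} -> Prop, bisimulation L & L set0 set0.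
Proof.
move=> lose; exists safe_pair; first exact: safe_bisimulation.
exists (empty_coloring 2 G), (empty_coloring 2 H), ord0; rewrite !ffunE.
by split=> // n /forces_wins.
Qed.

End SafeBisimulation.

(** * Cardinalities, definable sets and degrees under a bisimulation *)

Lemma bisimulation_sym (G H : digraph) (L : {set G} -> {set H} -> Prop) :
  bisimulation L -> bisimulation (fun X X' => L X' X).
Proof. by case. Qed.

(** Induction on the size of [X]: when one point is removed from [X], the pattern makes the answer a
    proper subset of [X']. *)
Lemma bisimulation_card_leq (G H : digraph) (L : {set G} -> {set H} -> Prop) X X' :
  bisimulation L -> L X X' -> #|X| <= #|X'|.
Proof.
case=> F _; have [n cX] : exists n, #|X| = n by exists #|X|.
elim: n X X' cX => [|n IHn] X X' cX LX; first by rewrite cX.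
have /card_gt0P[x xX] : 0 < #|X| by rewrite cX.
have cY : #|X :\ x| = n by move: (cardsD1 x X); rewrite xX cX => -[].
have [Y' LY [pat _]] := F _ _ LX (X :\ x).
rewrite cX; rewrite -cY; apply: leq_ltn_trans (_ : #|Y'| < _); first exact: IHn cY LY.
apply/proper_card/properP; split.
  apply/subsetP => y yY'; apply/negPn/negP => /negbTE yX'.
  have [|z []] := (pat false true).2; first by exists y.
  by rewrite !inE => ->; rewrite andbF.
have [|z [zX' zY']] := (pat true false).1; last by exists z; rewrite ?zY'.
by exists x; rewrite !inE eqxx.
Qed.

Lemma bisimulation_card (G H : digraph) (L : {set G} -> {set H} -> Prop) X X' :
  bisimulation L -> L X X' -> #|X| = #|X'|.
Proof.
move=> bL LX; apply/eqP; rewrite eqn_leq (bisimulation_card_leq bL LX) /=.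
exact: (bisimulation_card_leq (bisimulation_sym bL) LX).
Qed.

Lemma bisimulation_point (G H : digraph) (L : {set G} -> {set H} -> Prop) X X' x :
  bisimulation L -> L X X' -> x \in X -> exists2 x', x' \in X' & L [set x] [set x'].
Proof.
move=> bL LX xX; have [Y' LY [pat _]] := bL.1 _ _ LX [set x].
have : #|Y'| == 1 by rewrite -(bisimulation_card bL LY) cards1.
case/cards1P=> x' EY'; exists x'; last by rewrite -EY'.
have [|y [yX']] := (pat true true).1; first by exists x; rewrite inE eqxx.
by rewrite EY' inE => /eqP<-.
Qed.

(** A semantic notion: invariance along related singletons, with no formula involved. *)
Definition definable (G H : digraph) (L : {set G} -> {set H} -> Prop)
    (P : pred G) (P' : pred H) :=
  forall x x', L [set x] [set x'] -> P x = P' x'.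

Lemma definable_sym (G H : digraph) (L : {set G} -> {set H} -> Prop) P P' :
  definable L P P' -> definable (fun X X' => L X' X) P' P.
Proof. by move=> dP x' x /dP. Qed.

Lemma definable_subset (G H : digraph) (L : {set G} -> {set H} -> Prop) P P' X X' :
  bisimulation L -> definable L P P' -> L X X' ->
  X \subset P -> X' \subset P'.
Proof.
move=> bL dP LX /subsetP XP; apply/subsetP => x' x'X'.
have [x xX Lx] := bisimulation_point (bisimulation_sym bL) LX x'X'.
by rewrite unfold_in -(dP _ _ Lx); apply: XP.
Qed.

Definition non_edges (G : digraph) (P : pred G) x : pred G :=
  [pred y | P y && ~~ edge G x y].

Definition non_edges_to (G : digraph) (P : pred G) x : pred G :=
  [pred y | P y && ~~ edge G y x].

Lemma definable_card_leq (G H : digraph) (L : {set G} -> {set H} -> Prop) P P' :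
  bisimulation L -> L set0 set0 -> definable L P P' -> #|P| <= #|P'|.
Proof.
move=> bL L0 dP; have [X' LX _] := bL.1 _ _ L0 [set x in P].
rewrite -[#|P|]cardsE (bisimulation_card bL LX); apply: subset_leq_card.
by apply: (definable_subset bL dP LX); apply/subsetP => x; rewrite inE.
Qed.

(** Patterns only record whether some edge joins two classes. A set of non-neighbours is therefore
    answered by non-neighbours, while nothing similar holds for neighbours. *)
Lemma definable_non_edges_leq (G H : digraph) (L : {set G} -> {set H} -> Prop) P P' x x' :
  bisimulation L -> definable L P P' -> L [set x] [set x'] ->
  #|non_edges P x| <= #|non_edges P' x'| /\ #|non_edges_to P x| <= #|non_edges_to P' x'|.
Proof.
move=> bL dP Lx; split.
  have [X' LX [_ pat]] := bL.1 _ _ Lx [set y in non_edges P x].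
  rewrite -[#|non_edges P x|]cardsE (bisimulation_card bL LX); apply: subset_leq_card.
  apply/subsetP => y' y'X'; rewrite inE; apply/andP; split.
    apply: (subsetP (definable_subset bL dP LX _)) => //.
    by apply/subsetP => y; rewrite inE => /andP[].
  apply/negP => xy'.
  have [|u [v [/set1P-> _ _]]] :=
    (pat true (x' \in X') (y' \in [set x']) true).2.
    by exists x', y'; rewrite inE eqxx.
  by rewrite !inE => /andP[_ /negbTE->].
have [X' LX [_ pat]] := bL.1 _ _ Lx [set y in non_edges_to P x].
rewrite -[#|non_edges_to P x|]cardsE (bisimulation_card bL LX); apply: subset_leq_card.
apply/subsetP => y' y'X'; rewrite inE; apply/andP; split.
  apply: (subsetP (definable_subset bL dP LX _)) => //.
  by apply/subsetP => y; rewrite inE => /andP[].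
apply/negP => xy'.
have [|u [v [_ uP /set1P-> _]]] :=
  (pat (y' \in [set x']) true true (x' \in X')).2.
  by exists y', x'; rewrite !inE eqxx.
by move: uP; rewrite !inE => /andP[_ /negbTE->].
Qed.

(** Neighbours are counted as the complement of non-neighbours; the opposite inequalities come from
    the reversed bisimulation. *)
Lemma definable_degrees (G H : digraph) (L : {set G} -> {set H} -> Prop) P P' x x' :
  bisimulation L -> L set0 set0 -> definable L P P' -> L [set x] [set x'] ->
  \sum_y (P y && edge G x y) = \sum_y (P' y && edge H x' y) /\
  \sum_y (P y && edge G y x) = \sum_y (P' y && edge H y x').
Proof.
move=> bL L0 dP Lx.
have bL' := bisimulation_sym bL; have dP' := definable_sym dP.
have [le_out le_in] := definable_non_edges_leq bL dP Lx.
have [ge_out ge_in] := definable_non_edges_leq bL' dP' Lx.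
have le_card := definable_card_leq bL L0 dP.
have ge_card := definable_card_leq bL' L0 dP'.
have cardE (K : digraph) (Q : pred K) (e : pred K) :
    \sum_y (Q y && e y) + #|[pred y | Q y && ~~ e y]| = #|Q|.
  rewrite -!sum1_card ![\sum_(_ in _) 1]big_mkcond -big_split /=.
  apply: eq_bigr => y _ /=; rewrite !unfold_in /=.
  by case: (Q y) (e y) => [] [].
have oG : _ + #|non_edges P x| = #|P| := cardE _ P (edge G x).
have oH : _ + #|non_edges P' x'| = #|P'| := cardE _ P' (edge H x').
have iG : _ + #|non_edges_to P x| = #|P| := cardE _ P (edge G ^~ x).
have iH : _ + #|non_edges_to P' x'| = #|P'| := cardE _ P' (edge H ^~ x').
split; lia.
Qed.

(** * Degrees in the tournaments *)

(* Only j - i matters, so the 0-based indices used from here on give the same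
   arcs as the labels. *)
Definition tarc (i j : nat) : bool :=
  (i != j) && (odd_part (j%:Z - i%:Z)%R == 1 %[mod 4])%Z.

Lemma odd_part_odd (z : int) : odd `|z|%N -> odd_part z = z.
Proof. by move=> oz; rewrite /odd_part lognE /= dvdn2 oz andbF /= divz1. Qed.

Lemma odd_part_double (z : int) : z != 0%R -> odd_part (2 * z)%R = odd_part z.
Proof.
move=> z0; rewrite /odd_part abszM lognM ?absz_gt0 //= -[logn 2 2]/1 add1n expnS.
by rewrite PoszM divzMpl.
Qed.

Lemma arc_shift c i j : tarc (c + i) (c + j) = tarc i j.
Proof.
rewrite /tarc eqn_add2l; by have -> : ((c + j)%N%:Z - (c + i)%N%:Z = j%:Z - i%:Z)%R by lia.
Qed.

Lemma arc_double i j : tarc i.*2 j.*2 = tarc i j.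
Proof.
rewrite /tarc; have [->|neq_ij] := eqVneq i j; first by rewrite eqxx.
have -> : i.*2 != j.*2 by lia.
have -> : (j.*2%:Z - i.*2%:Z = 2 * (j%:Z - i%:Z))%R by lia.
by rewrite odd_part_double //; lia.
Qed.

(** Modulo 4, [3 * i] is [- i]; this avoids truncated subtraction. *)
Lemma arc_odd i j : odd (i + j) -> tarc i j = ((j + 3 * i) %% 4 == 1).
Proof.
move=> oij; rewrite /tarc; have -> : i != j by lia.
rewrite odd_part_odd; lia.
Qed.

(** An odd difference is 1 or 3 modulo 4 and its opposite is the other one; for equal parities, drop
    the common parity and halve. *)
Lemma arc_asym i j : i != j -> tarc j i = ~~ tarc i j.
Proof.
have [n] := ubnP (i + j); elim: n i j => // n IHn i j lt_n neq_ij.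
have [oij|eij] := boolP (odd (i + j)); first by rewrite !arc_odd //; lia.
have [Ei Ej] : i = odd i + i./2.*2 /\ j = odd i + j./2.*2 by lia.
by rewrite Ei Ej !arc_shift !arc_double IHn //; lia.
Qed.

Lemma sum_double n (f : nat -> nat) :
  \sum_(i < n.*2) f i = \sum_(i < n) (f i.*2 + f i.*2.+1).
Proof.
elim: n => [|n IHn]; first by rewrite !big_ord0.
by rewrite doubleS !big_ord_recr /= IHn /= addnA.
Qed.

(** The number of arcs between [i] and the first [2 ^ b] vertices of the other tournament, for
    entries [c] (odd sum) and [d] (even sum). The parity of [i] matters only for a single vertex,
    [b = 0]. *)
Definition cross b i (c d : bool) :=
  if b is b'.+1 then 2 ^ b' * (c + d) else if odd i then c : nat else d.

Lemma sum_parity b i (c d : bool) :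
  \sum_(j < 2 ^ b) (if odd (i + j) then c else d) = cross b i c d.
Proof.
case: b => [|b]; first by rewrite expn0 big_ord1 addn0 /=; case: odd.
rewrite expnS mul2n (sum_double _ (fun j => nat_of_bool (if odd (i + j) then c else d))).
under eq_bigr => j _ do rewrite addnS /= oddD odd_double addbF.
rewrite (eq_bigr (fun=> c + d)) => [|j _]; last by case: odd; rewrite // addnC.
by rewrite sum_nat_const card_ord.
Qed.

(** Along the vertices of the other parity, the differences alternate between 1 and 3 modulo 4. *)
Lemma sum_arc_opposite k i s : odd i != s ->
  \sum_(j < 2 ^ k.+1) tarc i (s + j.*2) = 2 ^ k.
Proof.
move=> i_s; rewrite expnS mul2n (sum_double _ (fun j => tarc i (s + j.*2) : nat)).
rewrite (eq_bigr (fun=> 1)) ?sum_nat_const ?card_ord ?muln1 // => j _.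
rewrite !arc_odd; lia.
Qed.

(** Vertices of the other parity contribute exactly half of their number; those of the same parity
    form a copy of the tournament of half the size, in which [i] becomes [i./2]. *)
Lemma arc_outdegree k i : i < 2 ^ k.+1 ->
  \sum_(j < 2 ^ k.+1) tarc i j = 2 ^ k - (2 ^ k <= i).
Proof.
elim: k i => [|k IHk] i lt_i; first by
  case: i lt_i => [|[|]] // _; rewrite !big_ord_recr big_ord0.
rewrite expnS mul2n (sum_double _ (fun j => tarc i j : nat)) big_split /=.
have lt_i2 : i./2 < 2 ^ k.+1 by move: lt_i; rewrite [2 ^ k.+2]expnS; lia.
have Ei : i = odd i + i./2.*2 by lia.
have same : \sum_(j < 2 ^ k.+1) tarc i (odd i + j.*2) = 2 ^ k - (2 ^ k <= i./2).
  rewrite -(IHk _ lt_i2); apply: eq_bigr => j _.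
  by rewrite {1}Ei arc_shift arc_double.
have opposite : \sum_(j < 2 ^ k.+1) tarc i (~~ odd i + j.*2) = 2 ^ k.
  by apply: sum_arc_opposite; case: odd.
have -> : 2 ^ k.+1 - (2 ^ k.+1 <= i) = 2 ^ k - (2 ^ k <= i./2) + 2 ^ k.
  by rewrite expnS; lia.
by move: same opposite; case: (odd i) => /= <- <-; rewrite // addnC.
Qed.

Lemma arc_indegree k i : i < 2 ^ k.+1 ->
  \sum_(j < 2 ^ k.+1) tarc j i = 2 ^ k - 1 + (2 ^ k <= i).
Proof.
move=> lt_i; have out := arc_outdegree lt_i.
have : \sum_(j < 2 ^ k.+1) (tarc i j + tarc j i) = 2 ^ k.+1 - 1.
  rewrite (bigD1 (Ordinal lt_i)) //= {1 2}/tarc eqxx /= !add0n.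
  rewrite (eq_bigr (fun=> 1)) => [|j]; last first.
    by rewrite -val_eqE /= => /arc_asym->; case: tarc.
  by rewrite sum1_card cardC1 card_ord subn1.
rewrite big_split /= out expnS; have := expn_gt0 2 k; lia.
Qed.

(** * Adjacencies and block degrees in the whole digraph *)

Definition label_edge m (w x y z : bool) i j : bool :=
  stockmeyer_entry m w x y z i.+1 j.+1.

Section Entries.
Variables (m : nat) (w x y z : bool).
Hypothesis m_gt0 : 0 < m.
Local Notation e := (label_edge m w x y z).

Lemma odd_pow2 : odd (2 ^ m) = false.
Proof. by rewrite oddX eqn0Ngt m_gt0. Qed.

Lemma edge_ll i j : i < 2 ^ m -> j < 2 ^ m -> e i j = tarc i j.
Proof.
move=> lt_i lt_j; rewrite /label_edge /stockmeyer_entry lt_i lt_j eqxx.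
exact: (arc_shift 1 i j).
Qed.

Lemma edge_rr i j : e (2 ^ m + i) (2 ^ m + j) = tarc i j.
Proof.
rewrite /label_edge /stockmeyer_entry !ltnNge !leq_addr eqxx.
by rewrite -(arc_shift (2 ^ m).+1 i j).
Qed.

Lemma edge_lr i j : i < 2 ^ m -> e i (2 ^ m + j) = if odd (i + j) then x else w.
Proof.
move=> lt_i; rewrite /label_edge /stockmeyer_entry lt_i ltnNge leq_addr /=.
by rewrite !addnS /= !negbK !oddD odd_pow2 /=; case: (odd i); case: odd.
Qed.

Lemma edge_rl i j : i < 2 ^ m -> e (2 ^ m + j) i = if odd (i + j) then z else y.
Proof.
move=> lt_i; rewrite /label_edge /stockmeyer_entry lt_i ltnNge leq_addr /=.
by rewrite !addnS /= !negbK !oddD odd_pow2 /=; case: (odd i); case: odd.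
Qed.

End Entries.

(* In 0-based indices: the first 2^a vertices of the large tournament and the
   first 2^b vertices of the small one. *)
Definition block m a b : pred nat :=
  fun i => (i < 2 ^ a) || (2 ^ m <= i < 2 ^ m + 2 ^ b).

Section Degrees.
Variables (m n : nat) (w x y z : bool).
Hypothesis m_gt0 : 0 < m.
Local Notation e := (label_edge m w x y z).

Lemma sum_ltn N N' (f : nat -> bool) : N <= N' ->
  \sum_(j < N') ((j < N) && f j) = \sum_(j < N) f j.
Proof.
move=> le_N; rewrite (big_ord_widen _ (fun j => f j : nat) le_N) [RHS]big_mkcond.
by apply: eq_bigr => j _; case: ifP.
Qed.

Lemma sum_block a b (f : nat -> bool) : a <= m -> b <= n ->
  \sum_(j < 2 ^ m + 2 ^ n) (block m a b j && f j) =
  \sum_(j < 2 ^ a) f j + \sum_(j < 2 ^ b) f (2 ^ m + j).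
Proof.
move=> le_a le_b; have le_a2 : 2 ^ a <= 2 ^ m by rewrite leq_exp2l.
have le_b2 : 2 ^ b <= 2 ^ n by rewrite leq_exp2l.
rewrite big_split_ord /= -(sum_ltn f le_a2) -(sum_ltn (fun j => f (2 ^ m + j)) le_b2).
congr (_ + _); apply: eq_bigr => j _; congr (nat_of_bool (_ && _)); rewrite /block.
  by have := ltn_ord j; lia.
by lia.
Qed.

Definition out_deg (P : pred nat) i := \sum_(j < 2 ^ m + 2 ^ n) (P j && e i j).
Definition in_deg (P : pred nat) i := \sum_(j < 2 ^ m + 2 ^ n) (P j && e j i).

Lemma block_degrees_l a b i : a < m -> b <= n -> i < 2 ^ a.+1 ->
  out_deg (block m a.+1 b) i = 2 ^ a - (2 ^ a <= i) + cross b i x w /\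
  in_deg (block m a.+1 b) i = 2 ^ a - 1 + (2 ^ a <= i) + cross b i z y.
Proof.
move=> lt_a le_b lt_i.
have lt_im : i < 2 ^ m by apply: leq_trans lt_i _; rewrite leq_exp2l.
have lt_jm (j : 'I_(2 ^ a.+1)) : j < 2 ^ m.
  by apply: leq_trans (ltn_ord j) _; rewrite leq_exp2l.
split; rewrite ?[out_deg _ _](sum_block (e i)) ?[in_deg _ _](sum_block (e ^~ i)) //
  -(sum_parity b i).
  rewrite -(arc_outdegree lt_i); congr (_ + _); apply: eq_bigr => j _.
    by rewrite edge_ll.
  by rewrite edge_lr.
rewrite -(arc_indegree lt_i); congr (_ + _); apply: eq_bigr => j _.
  by rewrite edge_ll.
by rewrite edge_rl.
Qed.

Lemma block_degrees_r a b i : a < m -> b <= n -> i < 2 ^ b ->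
  out_deg (block m a.+1 b) (2 ^ m + i) = 2 ^ a * (z + y) + \sum_(j < 2 ^ b) tarc i j /\
  in_deg (block m a.+1 b) (2 ^ m + i) = 2 ^ a * (x + w) + \sum_(j < 2 ^ b) tarc j i.
Proof.
move=> lt_a le_b lt_i.
have lt_jm (j : 'I_(2 ^ a.+1)) : j < 2 ^ m.
  by apply: leq_trans (ltn_ord j) _; rewrite leq_exp2l.
split; rewrite ?[out_deg _ _](sum_block (e _)) ?[in_deg _ _](sum_block (e ^~ _)) //;
  rewrite -[2 ^ a * _]/(cross a.+1 i _ _) -sum_parity; congr (_ + _);
  by apply: eq_bigr => j _; rewrite ?edge_rr ?edge_rl ?edge_lr // addnC.
Qed.

(* eps tells whether u lies in the second half of its interval; the two
   disjuncts are for u in the large and in the small tournament. *)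
Lemma block_halves a b u : a < m -> b < n -> block m a.+1 b.+1 u ->
  exists2 eps : bool, block m a b u = ~~ eps &
    (out_deg (block m a.+1 b.+1) u = 2 ^ a - eps + 2 ^ b * (x + w) /\
     in_deg (block m a.+1 b.+1) u = 2 ^ a - 1 + eps + 2 ^ b * (z + y)) \/
    (out_deg (block m a.+1 b.+1) u = 2 ^ a * (z + y) + (2 ^ b - eps) /\
     in_deg (block m a.+1 b.+1) u = 2 ^ a * (x + w) + (2 ^ b - 1 + eps)).
Proof.
move=> lt_a lt_b; rewrite {1}/block.
have le_a2 : 2 ^ a.+1 <= 2 ^ m by rewrite leq_exp2l.
have Sa := expnS 2 a.
have [lt_u _|le_u /andP[le_mu lt_u]] := ltnP u (2 ^ a.+1).
  exists (2 ^ a <= u); last by left; apply: block_degrees_l.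
  by rewrite /block; lia.
have Eu : u = 2 ^ m + (u - 2 ^ m) by lia.
have lt_u' : u - 2 ^ m < 2 ^ b.+1 by lia.
exists (2 ^ b <= u - 2 ^ m); first by rewrite /block; lia.
have := block_degrees_r lt_a lt_b lt_u'.
by rewrite -Eu arc_outdegree // arc_indegree //; right.
Qed.

Lemma out_deg_gt0 (P : pred nat) i j : j < 2 ^ m + 2 ^ n -> P j -> e i j -> 0 < out_deg P i.
Proof.
by move=> lt_j Pj eij; rewrite /out_deg (bigD1 (Ordinal lt_j)) //= Pj eij.
Qed.

Lemma in_deg_gt0 (P : pred nat) i j : j < 2 ^ m + 2 ^ n -> P j -> e j i -> 0 < in_deg P i.
Proof.
by move=> lt_j Pj eij; rewrite /in_deg (bigD1 (Ordinal lt_j)) //= Pj eij.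
Qed.

Lemma out_deg_eq0 (P : pred nat) i : (forall j, P j -> e i j = false) -> out_deg P i = 0.
Proof.
by move=> e0; rewrite /out_deg big1 // => j _; case Pj: (P j) => //=; rewrite e0.
Qed.

Lemma in_deg_eq0 (P : pred nat) i : (forall j, P j -> e j i = false) -> in_deg P i = 0.
Proof.
by move=> e0; rewrite /in_deg big1 // => j _; case Pj: (P j) => //=; rewrite e0.
Qed.

Lemma degree_pred1 i j : j < 2 ^ m + 2 ^ n ->
  out_deg (pred1 j) i = e i j /\ in_deg (pred1 j) i = e j i.
Proof.
move=> lt_j; rewrite /out_deg /in_deg; split; rewrite (bigD1 (Ordinal lt_j)) //= eqxx;
  by rewrite big1 ?addn0 // => k; rewrite -val_eqE /= => /negbTE->.
Qed.

End Degrees.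

(** * Colour refinement of the Stockmeyer digraphs *)

Definition agree (S : nat -> nat -> Prop) (P P' : pred nat) :=
  forall u v, S u v -> P u = P' v.

(** What colour refinement retains of the game, stated on indices. The second digraph has [w], [x]
    and [y], [z] exchanged, which gives the starred digraph of every family. *)
Definition stable m n (w x y z : bool) (S : nat -> nat -> Prop) :=
  [/\ forall u v, S u v -> u < 2 ^ m + 2 ^ n /\ v < 2 ^ m + 2 ^ n,
      forall u, u < 2 ^ m + 2 ^ n -> exists v, S u v,
      forall v, v < 2 ^ m + 2 ^ n -> exists u, S u v &
      forall P P', agree S P P' -> forall u v, S u v ->
        out_deg m n w x y z P u = out_deg m n x w z y P' v /\
        in_deg m n w x y z P u = in_deg m n x w z y P' v].

Lemma stable_sym m n w x y z S :
  stable m n w x y z S -> stable m n x w z y (fun u v => S v u).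
Proof.
case=> ltS toS fromS degS; split=> // [u v /ltS[] //|P P' PP' u v Suv].
have P'P : agree S P' P by move=> ? ? /PP'.
by have [-> ->] := degS _ _ P'P _ _ Suv.
Qed.

Section Stable.
Variables (m n : nat) (w x y z : bool) (S : nat -> nat -> Prop).
Hypotheses (lt_nm : n < m) (stS : stable m n w x y z S).
Hypothesis not_fixed : (w != x) || (y != z).

Let m_gt0 : 0 < m. Proof. exact: leq_ltn_trans lt_nm. Qed.

(** The exchange preserves [x + w] and [z + y], one of which is 1 by [not_fixed]. As the large
    interval is at least twice the small one, no vertex of a first half has both degrees of a vertex
    of a second half, even across the two tournaments. *)
Lemma block_agree k : k <= n -> agree S (block m (m - k) (n - k)) (block m (m - k) (n - k)).
Proof.
have [ltS _ _ degS] := stS.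
elim: k => [_|k IHk lt_kn] u v Suv.
  by have := ltS _ _ Suv; rewrite !subn0 /block; lia.
have [Da Db] : m - k = (m - k.+1).+1 /\ n - k = (n - k.+1).+1 by lia.
have := IHk (ltnW lt_kn); rewrite Da Db.
have lt_am : m - k.+1 < m by lia.
have lt_bn : n - k.+1 < n by lia.
have : n - k.+1 < m - k.+1 by lia.
move: (m - k.+1) (n - k.+1) lt_am lt_bn => a b lt_am lt_bn lt_ba agr.
have := agr _ _ Suv; have := degS _ _ agr _ _ Suv.
have mono i : block m a b i -> block m a.+1 b.+1 i.
  by rewrite /block !expnS; lia.
have [Bu|nBu] := boolP (block m a.+1 b.+1 u); last first.
  move=> _ Bv; case: (boolP (block m a b u)) => [/mono|_]; first by rewrite (negbTE nBu).
  by case: (boolP (block m a b v)) => [/mono|//]; rewrite -Bv.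
move=> deg /esym Bv.
have [eu -> du] := block_halves w x y z m_gt0 lt_am lt_bn Bu.
have [ev -> dv] := block_halves x w z y m_gt0 lt_am lt_bn Bv.
have le_ba : 2 * 2 ^ b <= 2 ^ a by rewrite -expnS leq_exp2l.
have b_gt0 : 0 < 2 ^ b by rewrite expn_gt0.
have [p_le2 q_le2] : x + w <= 2 /\ z + y <= 2 by case: w x y z => [] [] [] [].
have pq1 : x + w = 1 \/ z + y = 1.
  by move: not_fixed; case: w x y z => [] [] [] [] //=; auto.
congr (~~ _); move: deg => [].
rewrite [w + x]addnC [y + z]addnC in dv.
case: du => -[-> ->]; case: dv => -[-> ->]; move: pq1 p_le2 q_le2;
  move: le_ba b_gt0; move: (x + w) (z + y) (2 ^ a) (2 ^ b) => p q A B;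
  case: eu ev => [] [] //; case: p => [|[|[|//]]]; case: q => [|[|[|//]]];
  rewrite ?muln0 ?muln1; lia.
Qed.

Local Notation apex := (2 ^ m).

Lemma last_block_agree : agree S (block m (m - n) 0) (block m (m - n) 0).
Proof. by have := block_agree (leqnn n); rewrite subnn. Qed.

(** Without the apex, the last block is an initial interval. All arcs inside it are tournament arcs,
    so out-degrees separate its halves, down to the single vertex 0. *)
Lemma interval_agree : agree S (pred1 apex) (pred1 apex) ->
  forall k, k <= m - n -> agree S (fun i => i < 2 ^ k) (fun i => i < 2 ^ k).
Proof.
have [_ _ _ degS] := stS.
move=> apexS k le_k; rewrite -(subKn le_k); have: m - n - k <= m - n by lia.
elim: {k le_k}(m - n - k) => [|k IHk] le_k u v Suv.
  have := last_block_agree Suv; have := apexS _ _ Suv.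
  have le_r : 2 ^ (m - n) <= 2 ^ m by rewrite leq_exp2l //; lia.
  by rewrite subn0 /block /=; lia.
have Er : m - n - k = (m - n - k.+1).+1 by lia.
have := IHk (ltnW le_k); rewrite Er; have: m - n - k.+1 < m by lia.
move: (m - n - k.+1) => l lt_l IH; have IHuv := IH _ _ Suv.
have [+ _] := degS _ _ IH _ _ Suv; rewrite /out_deg.
have le_l : 2 ^ l.+1 <= 2 ^ m by rewrite leq_exp2l.
rewrite !(sum_ltn (label_edge _ _ _ _ _ _)) ?(leq_trans le_l) ?leq_addr //.
have [lt_u|le_u] := ltnP u (2 ^ l.+1); last by move: IHuv le_u; rewrite expnS; lia.
have lt_v : v < 2 ^ l.+1 by rewrite -IHuv.
have sum_arc a b c d i : i < 2 ^ l.+1 ->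
    \sum_(j < 2 ^ l.+1) label_edge m a b c d i j = 2 ^ l - (2 ^ l <= i).
  move=> lt_i; rewrite -arc_outdegree //; apply: eq_bigr => j _.
  by rewrite edge_ll // (leq_trans _ le_l).
by rewrite !sum_arc //; have := expn_gt0 2 l; lia.
Qed.

(** Vertex 0 is then related only to itself, and its degrees into the singleton of the apex are its
    adjacencies with the apex. *)
Lemma apex_not_agree : ~ agree S (pred1 apex) (pred1 apex).
Proof.
move=> apexS; have [_ toS _ degS] := stS.
have [|v S0v] := toS 0; first by rewrite addn_gt0 expn_gt0.
have := interval_agree apexS (leq0n _) S0v.
rewrite expn0; case: v S0v => // S0 _.
have lt_apex : apex < 2 ^ m + 2 ^ n by rewrite -addn1 leq_add2l expn_gt0.
have := degS _ _ apexS _ _ S0.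
have [-> ->] := degree_pred1 w x y z 0 lt_apex.
have [-> ->] := degree_pred1 x w z y 0 lt_apex.
have lt_0 : 0 < 2 ^ m by rewrite expn_gt0.
have lr a b c d := edge_lr a b c d m_gt0 0 lt_0; have rl a b c d := edge_rl a b c d m_gt0 0 lt_0.
rewrite addn0 in lr; rewrite addn0 in rl.
by rewrite !lr !rl /=; move: not_fixed; case: w x y z => [] [] [] [] //= _ [].
Qed.

End Stable.

Lemma last_block_degrees m n w x y z q u : q < m -> block m q.+1 0 u ->
  (u < 2 ^ q.+1 /\
   (out_deg m n w x y z (block m q.+1 0) u =
      2 ^ q - (2 ^ q <= u) + (if odd u then x else w) /\
    in_deg m n w x y z (block m q.+1 0) u =
      2 ^ q - 1 + (2 ^ q <= u) + (if odd u then z else y))) \/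
  (u = 2 ^ m /\
   (out_deg m n w x y z (block m q.+1 0) u = 2 ^ q * (z + y) /\
    in_deg m n w x y z (block m q.+1 0) u = 2 ^ q * (x + w))).
Proof.
move=> lt_q Bu; have m_gt0 : 0 < m by apply: leq_ltn_trans lt_q.
have [lt_u|le_u] := ltnP u (2 ^ q.+1).
  left; split=> //.
  have [-> ->] := block_degrees_l w x y z m_gt0 lt_q (leq0n n) lt_u.
  by rewrite /cross; case: (odd u).
have Eu : u = 2 ^ m + 0 by move: Bu; rewrite /block; lia.
right; rewrite Eu; have [//|-> ->] := block_degrees_r w x y z m_gt0 lt_q (leq0n n) (i := 0).
by rewrite !big_ord1 /= !addn0.
Qed.

(** The last block is 0, 1 and the apex. By degrees, vertex 0 of either digraph can only be related
    to the apex of the other, and both relations together force [w = x] and [y = z]. *)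
Lemma succ_not_stable m n w x y z S : m = n.+1 -> (w != x) || (y != z) ->
  ~ stable m n w x y z S.
Proof.
move=> Em not_fixed stS; have [_ toS fromS degS] := stS.
have lt_nm : n < m by rewrite Em.
have := last_block_agree lt_nm stS not_fixed; have -> : m - n = 1 by lia.
move=> agr; have m_gt0 : 0 < m by lia.
have B0 : block m 1 0 0 by [].
have [|v S0v] := toS 0; first by rewrite addn_gt0 expn_gt0.
have [|u Su0] := fromS 0; first by rewrite addn_gt0 expn_gt0.
have Bv : block m 1 0 v by rewrite -(agr _ _ S0v).
have Bu : block m 1 0 u by rewrite (agr _ _ Su0).
have [+ _] := degS _ _ agr _ _ S0v; have [_ +] := degS _ _ agr _ _ S0v.
have [+ _] := degS _ _ agr _ _ Su0; have [_ +] := degS _ _ agr _ _ Su0.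
have m1 : 1 <= 2 ^ m by rewrite expn_gt0.
clear S stS toS fromS degS agr S0v Su0.
have [[_ [-> ->]]|[E0 _]] := last_block_degrees n w x y z m_gt0 B0; last by lia.
have [[_ [-> ->]]|[E0 _]] := last_block_degrees n x w z y m_gt0 B0; last by lia.
have [[ltu [-> ->]]|[_ [-> ->]]] := last_block_degrees n w x y z m_gt0 Bu;
have [[ltv [-> ->]]|[_ [-> ->]]] := last_block_degrees n x w z y m_gt0 Bv.
- case: u ltu {Bu} => [|[|//]] _; case: v ltv {Bv} => [|[|//]] _ /=;
  by move: not_fixed; case: w x y z => [] [] [] [].
- case: u ltu {Bu} => [|[|//]] _ /=;
  by move: not_fixed; case: w x y z => [] [] [] [].
- case: v ltv {Bv} => [|[|//]] _ /=;
  by move: not_fixed; case: w x y z => [] [] [] [].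
by move: not_fixed; case: w x y z => [] [] [] [].
Qed.

(** The apex has degrees that are multiples of [2 ^ q], while the other vertices of the last block
    have both degrees within 1 of [2 ^ q]. A coincidence forces [x + w = z + y = 1] and
    complementary entries, the excluded case of D and its star. *)
Lemma apex_agree m n w x y z S : n.+1 < m -> (w != x) || (y != z) ->
  ~~ [&& w == z, x == y & w != x] -> stable m n w x y z S ->
  agree S (pred1 (2 ^ m)) (pred1 (2 ^ m)).
Proof.
move=> lt_nm not_fixed notD stS u v Suv; have [_ _ _ degS] := stS.
have := last_block_agree (ltnW lt_nm) stS not_fixed.
have [q [Eq q_gt0 lt_q]] : exists q, [/\ m - n = q.+1, 0 < q & q < m].
  by exists (m - n).-1; split; lia.
rewrite Eq => agr.
have := agr _ _ Suv; have := degS _ _ agr _ _ Suv.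
have [Bu deg Bv|nBu _ nBv] := boolP (block m q.+1 0 u); last first.
  by move: nBu nBv; rewrite /block /=; lia.
have M_gt1 : 1 < 2 ^ q := leq_ltn_trans q_gt0 (ltn_expl q (isT : 1 < 2)).
have le_q : 2 ^ q.+1 <= 2 ^ m by rewrite leq_exp2l.
move: deg; have := last_block_degrees n w x y z lt_q Bu.
have := last_block_degrees n x w z y lt_q (esym Bv).
clear S stS Suv degS agr; rewrite /=.
move=> [] [Hv [-> ->]] [] [Hu [-> ->]] [].
- by lia.
- rewrite Hu eqxx; move: not_fixed notD.
  by case: w x y z => [] [] [] [] //=; case: (odd v); rewrite ?muln0 ?muln1; lia.
- rewrite Hv eqxx; move: not_fixed notD.
  by case: w x y z => [] [] [] [] //=; case: (odd u); rewrite ?muln0 ?muln1; lia.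
by rewrite Hu Hv.
Qed.

(* For D on the last block, out- and in-degrees only give the three classes low,
   high and middle; the apex shares the middle class with other vertices, and
   (with more than four vertices besides it) is the only one of them with no
   edge to low and none from high. *)
Section FamilyD.
Variables (m n q : nat) (S : nat -> nat -> Prop).
Hypotheses (Dq : m - n = q.+1) (q_gt0 : 0 < q).
Hypothesis stS : stable m n true false false true S.

Local Notation apex := (2 ^ m).

Let m_gt0 : 0 < m. Proof. by lia. Qed.
Let lt_nm : n < m. Proof. by lia. Qed.
Let lt_q : q < m. Proof. by lia. Qed.

(** The parameter [p] is false for D and true for its star. The vertices of [low p] have out- and
    in-degree [2 ^ q + 1] and [2 ^ q - 1], those of [high (~~ p)] the reverse, and those of
    [middle p], apex included, twice [2 ^ q]. *)
Let low p i := (i < 2 ^ q) && (odd i == p).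
Let high p i := (2 ^ q <= i < 2 ^ q.+1) && (odd i == p).
Let middle p i := [&& block m q.+1 0 i, ~~ low p i & ~~ high (~~ p) i].

Let M_gt1 : 1 < 2 ^ q := leq_ltn_trans q_gt0 (ltn_expl q (isT : 1 < 2)).
(* Not named in the proofs below, but lia finds it in the context. *)
Let M_even : odd (2 ^ q) = false. Proof. by rewrite oddX eqn0Ngt q_gt0. Qed.
Let le_M2 : 2 ^ q.+1 <= 2 ^ m. Proof. by rewrite leq_exp2l. Qed.

Lemma D_block_agree : agree S (block m q.+1 0) (block m q.+1 0).
Proof. by rewrite -Dq; apply: last_block_agree stS _. Qed.

Lemma D_classes : agree S (low false) (low true) /\ agree S (high true) (high false).
Proof.
have [_ _ _ degS] := stS.
suff cls u v : S u v -> low false u = low true v /\ high true u = high false v.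
  by split=> u v /cls[].
move=> Suv; have := D_block_agree Suv; have := degS _ _ D_block_agree _ _ Suv.
have [Bu deg Bv|nBu _ nBv] := boolP (block m q.+1 0 u); last first.
  by move: nBu nBv M_gt1; rewrite /block /low /high expnS; lia.
move: deg; have := last_block_degrees n true false false true lt_q Bu.
have := last_block_degrees n false true true false lt_q (esym Bv).
have := expnS 2 q; rewrite /low /high; move: M_gt1 le_M2.
by move=> ? ? ? [] [Hv [-> ->]] [] [Hu [-> ->]] [];
  case: (odd u); case: (odd v); rewrite /= ?muln0 ?muln1; lia.
Qed.

Lemma D_middle_agree : agree S (middle false) (middle true).
Proof.
by move=> u v Suv; rewrite /middle (D_block_agree Suv) (D_classes.1 _ _ Suv)
  (D_classes.2 _ _ Suv).
Qed.

Lemma D_middle_out a b c d p u :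
  (u < 2 ^ q.+1 -> out_deg m n a b c d (middle p) u =
    \sum_(j < 2 ^ q.+1) [&& ~~ low p j, ~~ high (~~ p) j & tarc u j] +
    (if odd u then b else a)) /\
  out_deg m n a b c d (middle p) apex =
    \sum_(j < 2 ^ q.+1) [&& ~~ low p j, ~~ high (~~ p) j & if odd j then d else c].
Proof.
have splitE i : out_deg m n a b c d (middle p) i =
    \sum_(j < 2 ^ q.+1) [&& ~~ low p j, ~~ high (~~ p) j & label_edge m a b c d i j] +
    label_edge m a b c d i (apex + 0).
  have apex_in : [&& ~~ low p (apex + 0) & ~~ high (~~ p) (apex + 0)].
    by rewrite /low /high addn0; have := expnS 2 q; lia.
  transitivity (\sum_(j < 2 ^ m + 2 ^ n) (block m q.+1 0 j &&
      ([&& ~~ low p j, ~~ high (~~ p) j & label_edge m a b c d i j]))).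
    by apply: eq_bigr => j _; rewrite /middle -!andbA.
  rewrite (sum_block m_gt0
    (fun j => [&& ~~ low p j, ~~ high (~~ p) j & label_edge m a b c d i j])) //.
  by rewrite big_ord1; case/andP: apex_in => -> ->.
split=> [lt_u|]; rewrite splitE.
  rewrite edge_lr ?(leq_trans lt_u) // addn0; congr (_ + _); apply: eq_bigr => j _.
  by rewrite edge_ll // (leq_trans _ le_M2).
have := edge_rr m a b c d 0 0; rewrite !addn0 => ->; rewrite addn0; apply: eq_bigr => j _.
have := edge_rl a b c d m_gt0 0 (leq_trans (ltn_ord j) le_M2).
by rewrite !addn0 => ->.
Qed.

(* With four vertices besides the apex, the middle class is a directed 3-cycle in one digraph
   and a transitive tournament in the other. *)
Lemma D_four_not_stable : q = 1 -> False.
Proof.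
move=> q1; have [_ _ fromS degS] := stS.
have m4 : 4 <= 2 ^ m by rewrite (leq_exp2l 2 m (isT : 1 < 2)); lia.
(* In the starred digraph the middle class is 0, 3 and the apex, and 3 is its source, of out-degree
   2. In the 3-cycle on 1, 2 and the apex, every out-degree is 1. *)
have [|u Su3] := fromS 3; first by rewrite (leq_trans m4) ?leq_addr.
have := D_middle_agree Su3; have [+ _] := degS _ _ D_middle_agree _ _ Su3.
have lt_4 i : i < 4 -> i < 2 ^ q.+1 by rewrite q1.
rewrite (D_middle_out _ _ _ _ _ 3).1 ?lt_4 //; move=> deg mid.
have {}mid : middle false u by rewrite mid /middle /block /low /high q1.
have [Eu|[Eu|Eu]] : u = 1 \/ u = 2 \/ u = apex.
  by move: mid; rewrite /middle /block /low /high q1 expn0 /=; lia.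
all: move: deg; rewrite Eu ?(D_middle_out _ _ _ _ _ 0).2 ?(D_middle_out _ _ _ _ _ _).1 ?lt_4 //.
all: by rewrite /low /high q1 !big_ord_recr !big_ord0 /=; vm_compute.
Qed.

Lemma D_apex_agree : 1 < q -> agree S (pred1 apex) (pred1 apex).
Proof.
move=> q_gt1 u v Suv; have [_ _ _ degS] := stS.
have [lowS highS] := D_classes.
have [out_uv _] := degS _ _ lowS _ _ Suv; have [_ in_uv] := degS _ _ highS _ _ Suv.
have mid_uv := D_middle_agree Suv.
have M4 : 4 <= 2 ^ q by rewrite (leq_exp2l 2 q (isT : 1 < 2)).
have SM := expnS 2 q.
have lt_N i : i < 2 ^ q.+1 -> i < 2 ^ m + 2 ^ n.
  by move=> lt_i; rewrite (leq_trans lt_i) // (leq_trans le_M2) ?leq_addr.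
have eE a b c d i j : i < 2 ^ q.+1 -> j < 2 ^ q.+1 -> odd (i + j) ->
    label_edge m a b c d i j = ((j + 3 * i) %% 4 == 1).
  by move=> lt_i lt_j oij; rewrite edge_ll ?arc_odd // (leq_trans _ le_M2).
have apex_mid p : middle p apex by rewrite /middle /low /high /block expn0; lia.
apply/eqP/eqP => [Eu|Ev].
  have out0 : out_deg m n true false false true (low false) u = 0.
    apply: out_deg_eq0 => j /andP[lt_j /eqP oj]; rewrite Eu -[2 ^ m]addn0.
    by rewrite edge_rl ?addn0 ?oj //; lia.
  have in0 : in_deg m n true false false true (high true) u = 0.
    apply: in_deg_eq0 => j /andP[lt_j /eqP oj]; rewrite Eu -[2 ^ m]addn0.
    by rewrite edge_lr ?addn0 ?oj //; lia.
  move: mid_uv; rewrite Eu apex_mid => /esym/and3P[Bv nlow nhigh].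
  apply/eqP; have [//|ne_v] := eqVneq v apex; exfalso.
  have lt_v : v < 2 ^ q.+1 by move: Bv ne_v; rewrite /block; lia.
  have [lt_vM|le_vM] := ltnP v (2 ^ q).
    have ev : odd v = false by move: nlow; rewrite /low lt_vM; case: odd.
    have : 0 < out_deg m n false true true false (low true) v.
      apply: (out_deg_gt0 (j := v.+1)); first by apply: lt_N; lia.
        by rewrite /low /= ev; lia.
      by rewrite eE; lia.
    by lia.
  have ov : odd v by move: nhigh; rewrite /high le_vM lt_v; case: odd.
  have : 0 < in_deg m n false true true false (high false) v.
    apply: (in_deg_gt0 (j := v.-1)); first by apply: lt_N; lia.
      by rewrite /high; lia.
    by rewrite eE; lia.
  by lia.
have out0 : out_deg m n false true true false (low true) v = 0.
  apply: out_deg_eq0 => j /andP[lt_j /eqP oj]; rewrite Ev -[2 ^ m]addn0.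
  by rewrite edge_rl ?addn0 ?oj //; lia.
have in0 : in_deg m n false true true false (high false) v = 0.
  apply: in_deg_eq0 => j /andP[lt_j /eqP oj]; rewrite Ev -[2 ^ m]addn0.
  by rewrite edge_lr ?addn0 ?oj //; lia.
move: mid_uv; rewrite Ev apex_mid => /and3P[Bu nlow nhigh].
apply/eqP; have [//|ne_u] := eqVneq u apex; exfalso.
have lt_u : u < 2 ^ q.+1 by move: Bu ne_u; rewrite /block; lia.
have [lt_uM|le_uM] := ltnP u (2 ^ q).
  have ou : odd u by move: nlow; rewrite /low lt_uM; case: odd.
  have : 0 < out_deg m n true false false true (low false) u.
    have [j [lt_j ej cj]] : exists j, [/\ j < 2 ^ q, ~~ odd j & (j + 3 * u) %% 4 = 1].
      (* The successor of [u] may leave the first half, so [u - 3] is taken when it exists;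
         otherwise [u = 1], and [2 < 2 ^ q] because [1 < q]. *)
      by have [lt3|ge3] := ltnP u 3; [exists u.+1 | exists (u - 3)]; split; lia.
    apply: (out_deg_gt0 (j := j)); first by apply: lt_N; lia.
      by rewrite /low; lia.
    by rewrite eE; lia.
  by lia.
have eu : odd u = false by move: nhigh; rewrite /high le_uM lt_u; case: odd.
have : 0 < in_deg m n true false false true (high true) u.
  have [j [le_j lt_j oj cj]] : exists j,
      [/\ 2 ^ q <= j, j < 2 ^ q.+1, odd j & (u + 3 * j) %% 4 = 1].
    (* For [u = 2 ^ q] the predecessor lies in the first half; [u + 3] stays in the second half
       since [4 <= 2 ^ q]. *)
    by have [lt_Mu|le_uM'] := ltnP (2 ^ q) u; [exists u.-1 | exists (u + 3)]; split; lia.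
  apply: (in_deg_gt0 (j := j)); first by apply: lt_N.
    by rewrite /high; lia.
  by rewrite eE; lia.
by lia.
Qed.

End FamilyD.

Lemma not_stable m n w x y z S : n < m -> (w != x) || (y != z) ->
  ~ stable m n w x y z S.
Proof.
move=> lt_nm not_fixed stS.
have [Em|ne_m] := eqVneq m n.+1; first exact: (succ_not_stable Em not_fixed stS).
have lt_n1m : n.+1 < m by lia.
have not_D T : ~ stable m n true false false true T.
  move=> stT; have Dq : m - n = (m - n).-1.+1 by lia.
  have q_gt0 : 0 < (m - n).-1 by lia.
  apply: (apex_not_agree lt_nm stT isT); apply: (D_apex_agree Dq q_gt0 stT).
  rewrite ltn_neqAle q_gt0 andbT eq_sym; apply/eqP.
  exact: D_four_not_stable Dq q_gt0 stT.
have [isD|notD] := boolP [&& w == z, x == y & w != x]; last first.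
  exact: (apex_not_agree lt_nm stS not_fixed (apex_agree lt_n1m not_fixed notD stS)).
move: w x y z isD stS {not_fixed} => [] [] [] [] //= _.
  exact: not_D.
by move/stable_sym; apply: not_D.
Qed.

(** If the game were lost, the bisimulation restricted to singletons would be a stable relation; it
    is total on both sides because a singleton can be played against the empty sets. *)
Lemma stockmeyer_digraph_wins m n w x y z : n < m -> (w != x) || (y != z) ->
  forall_wins_seurat 2 (stockmeyer_digraph m n w x y z) (stockmeyer_digraph m n x w z y).
Proof.
move=> lt_nm not_fixed; apply: NNPP => /bisimulation_of_loss[L bL L0].
pose S i j := exists (u : stockmeyer_digraph m n w x y z)
  (v : stockmeyer_digraph m n x w z y),
  [/\ i = val (u : 'I__), j = val (v : 'I__) & L [set u] [set v]].
apply: (@not_stable m n w x y z S lt_nm not_fixed); split.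
- by move=> _ _ [u [v [-> -> _]]]; split; apply: ltn_ord.
- move=> i lt_i; pose u : stockmeyer_digraph m n w x y z := Ordinal lt_i.
  have [X' LX _] := bL.1 _ _ L0 [set u].
  have [v _ Luv] := bisimulation_point bL LX (set11 u).
  by exists (val (v : 'I__)), u, v.
- move=> i lt_i; pose v : stockmeyer_digraph m n x w z y := Ordinal lt_i.
  have [X LX _] := bL.2 _ _ L0 [set v].
  have [u _ Luv] := bisimulation_point (bisimulation_sym bL) LX (set11 v).
  by exists (val (u : 'I__)), u, v.
move=> P P' PP' _ _ [u [v [-> -> Luv]]].
pose Q (u : stockmeyer_digraph m n w x y z) := P (val (u : 'I__)).
pose Q' (v : stockmeyer_digraph m n x w z y) := P' (val (v : 'I__)).
have QQ' : definable L Q Q' by move=> a b Lab; apply: PP'; exists a, b.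
exact: definable_degrees bL L0 QQ' Luv.
Qed.

Theorem theorem7p12 (m n : nat) (hnm : n < m) (Z : stockmeyer_family) :
  forall_wins_seurat 2 (stockmeyer Z m n) (stockmeyer_star Z m n).
Proof. by case: Z; apply: stockmeyer_digraph_wins. Qed.
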